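(* Let $k$ be a commutative ring with unit and let $F$ be an $\mathcal{F}$-module over $k$. Then cyclic Gamma homology of $F$ coincides with Gamma homology of the induced $\Gamma$-module $\mu^*F$ in degrees greater than $1$, i.e. $$H\Gamma C_n(F)=\mathrm{Tor}_n^{\mathcal{F}}(\overline{t},F)\;\cong\;\mathrm{Tor}_n^{\Gamma}(t,\mu^*F)=H\Gamma_n(\mu^*F)\qquad\text{for all } n>1.$$
   Context: $\mathcal{F}$ is the skeleton of the category of finite (unpointed) sets with objects $\underline{n}=\{0,\dots,n\}$, $n\ge0$, and all maps; an $\mathcal{F}$-module is a covariant functor from $\mathcal{F}$ to $k$-modules. $\Gamma$ is the skeleton of the category of finite pointed sets with objects $[n]=\{0,\dots,n\}$, $n\ge0$, based at $0$, and pointed maps; a $\Gamma$-module is a covariant functor from $\Gamma$ to $k$-modules. The forgetful functor is $\mu\colon\Gamma\to\mathcal{F}$, $[n]\mapsto\underline{n}$, and its left adjoint is $\nu\colon\mathcal{F}\to\Gamma$, $\nu(\underline{m})=[m+1]$, adding an extra basepoint; $\mu^*$ and $\nu^*$ denote precomposition (for covariant or contravariant functors). For a contravariant functor $T$ and a covariant functor $G$ on one of these categories with values in $k$-modules, $T\otimes G$ over the category is the tensor product of functors (coend), and $\mathrm{Tor}_*$ denotes its left derived functors. $t$ is the contravariant functor on $\Gamma$ given by $t[n]=\mathrm{Hom}_{\mathsf{Sets}_*}([n],k)$ (pointed maps, $k$ based at $0$). $\mathcal{F}_0$ is the contravariant functor on $\mathcal{F}$ with $\mathcal{F}_0(\underline{m})=k[\mathcal{F}(\underline{m},\underline{0})]$,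 the free $k$-module on $\mathcal{F}(\underline{m},\underline{0})$. The contravariant functor $\overline{t}$ on $\mathcal{F}$ is defined by the exact sequence $0\to\mathcal{F}_0\to\nu^*t\to\overline{t}\to0$, where $\mathcal{F}_0\to\nu^*t$ sends $\lambda f$ ($\lambda\in k$, $f\colon\underline{n}\to\underline{0}$) to the function in $\mathrm{Hom}_{\mathsf{Sets}_*}([n+1],k)$ with value $\lambda$ on $1,\dots,n+1$. Gamma homology of a $\Gamma$-module $G$ is $H\Gamma_n(G)=\mathrm{Tor}_n^\Gamma(t,G)$. Cyclic Gamma homology of an $\mathcal{F}$-module $F$ is $H\Gamma C_n(F)=\mathrm{Tor}_n^{\mathcal{F}}(\overline{t},F)$. *)

(* Defs.v *)
From HB Require Import structures.
From mathcomp Require Import all_boot all_order all_algebra.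
From mathcomp Require Import boolp classical_sets functions cardinality fsbigop.

Set Implicit Arguments.
Unset Strict Implicit.
Unset Printing Implicit Defensive.

Import GRing.Theory.
Local Open Scope quotient_scope.
Local Open Scope classical_set_scope.
Local Open Scope ring_scope.

Record submodule (k : pzRingType) (V : lmodType k) := Submodule {
  smem :> {pred V};
  smem_closed : submod_closed smem }.

HB.instance Definition _ (k : pzRingType) (V : lmodType k) (S : submodule V) :=
  GRing.isSubmodClosed.Build k V (smem S)
    (GRing.submod_closed_semi (smem_closed S)).
(* [submodClosed] does not record closure under opposites, which quotients need. *)
HB.instance Definition _ (k : pzRingType) (V : lmodType k) (S : submodule V) :=
  GRing.isZmodClosed.Build V (smem S) (GRing.submod_closedB (smem_closed S)).

Section Submodules.
Context {k : pzRingType}.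
Implicit Types V W : lmodType k.

Lemma full_sub_closed V : submod_closed (predT : {pred V}).
Proof. by split. Qed.
Definition full_sub V := Submodule (@full_sub_closed V).

Lemma ker_sub_closed V W (f : {linear V -> W}) :
  submod_closed (fun x => f x == 0 : bool).
Proof.
split=> [|a u v]; rewrite !unfold_in ?linear0 // => /eqP fu /eqP fv.
by rewrite linearP fu fv scaler0 addr0.
Qed.
Definition ker_sub V W (f : {linear V -> W}) := Submodule (ker_sub_closed f).

Lemma img_sub_closed V W (f : {linear V -> W}) :
  submod_closed (fun y => `[< exists x, f x = y >]).
Proof.
split=> [|a u v]; rewrite !unfold_in.
  by apply/asboolP; exists 0; rewrite linear0.
move=> /asboolP[x <-] /asboolP[y <-].
by apply/asboolP; exists (a *: x + y); rewrite linearP.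
Qed.
Definition img_sub V W (f : {linear V -> W}) := Submodule (img_sub_closed f).

Lemma pre_sub_closed V W (f : {linear V -> W}) (S : submodule W) :
  submod_closed (fun x => f x \in S).
Proof.
split=> [|a u v fu fv]; first by rewrite -[_ \in _]/(f 0 \in S) linear0 rpred0.
by rewrite -[_ \in _]/(f (a *: u + v) \in S) linearP rpredD ?rpredZ.
Qed.
Definition pre_sub V W (f : {linear V -> W}) (S : submodule W) :=
  Submodule (pre_sub_closed f S).

Lemma span_sub_closed V (A : set V) : submod_closed (fun x =>
  `[< forall S : submodule V, (forall y, A y -> y \in S) -> x \in S >]).
Proof.
split=> [|a u v]; rewrite !unfold_in.
  by apply/asboolP => S _; rewrite rpred0.
move=> /asboolP Su /asboolP Sv; apply/asboolP => S AS.
by rewrite rpredD ?rpredZ ?Su ?Sv.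
Qed.
Definition span_sub V (A : set V) := Submodule (span_sub_closed A).

End Submodules.

Section SubmoduleType.
Context {k : pzRingType} {V : lmodType k}.

Record submod (S : submodule V) :=
  Submod { submod_val :> V; submodP : submod_val \in S }.

Variable S : submodule V.
HB.instance Definition _ := [isSub for @submod_val S].
HB.instance Definition _ := [Choice of submod S by <:].
HB.instance Definition _ := [SubChoice_isSubLmodule of submod S by <:].

Definition submod_incl (x : submod S) : V := val x.
Lemma submod_incl_is_linear : linear submod_incl.
Proof. by move=> a x y; rewrite /submod_incl linearP. Qed.
HB.instance Definition _ :=
  GRing.isLinear.Build k (submod S) V _ submod_incl submod_incl_is_linear.

Variables (W : lmodType k) (f : {linear W -> V}) (fS : forall x, f x \in S).
Definition submod_corestr (x : W) : submod S := Submod (fS x).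
Lemma submod_corestr_is_linear : linear submod_corestr.
Proof. by move=> a x y; apply: val_inj; rewrite /= !linearP. Qed.
HB.instance Definition _ :=
  GRing.isLinear.Build k W (submod S) _ submod_corestr submod_corestr_is_linear.

End SubmoduleType.

Section QuotientModule.
Context {k : pzRingType} {V : lmodType k}.
Variable S : submodule V.

Definition quotmod := Quotient.quot S.
HB.instance Definition _ := GRing.Zmodule.on quotmod.

Definition quot_proj (x : V) : quotmod := \pi_(Quotient.quot S) x.

Lemma quot_projK (q : quotmod) : quot_proj (repr q) = q.
Proof. exact: reprK. Qed.

Lemma quot_projP x y : quot_proj x = quot_proj y <-> x - y \in S.
Proof.
rewrite Quotient.idealrBE.
by split=> /eqP.
Qed.

Lemma quot_projD x y : quot_proj (x + y) = quot_proj x + quot_proj y.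
Proof. exact: (raddfD \pi_(Quotient.quot S)). Qed.

Definition quot_scale (a : k) (q : quotmod) : quotmod := quot_proj (a *: repr q).

Lemma quot_scaleE a x : quot_scale a (quot_proj x) = quot_proj (a *: x).
Proof.
apply/quot_projP; rewrite -scalerBr rpredZ //.
by apply/quot_projP; rewrite quot_projK.
Qed.

Lemma quot_scaleA a b q : quot_scale a (quot_scale b q) = quot_scale (a * b) q.
Proof. by rewrite -[q]quot_projK !quot_scaleE scalerA. Qed.
Lemma quot_scale1 : left_id 1 quot_scale.
Proof. by move=> q; rewrite -[q]quot_projK quot_scaleE scale1r. Qed.
Lemma quot_scaleDr : right_distributive quot_scale +%R.
Proof.
move=> a q r; rewrite -[q]quot_projK -[r]quot_projK.
by rewrite -quot_projD !quot_scaleE scalerDr quot_projD.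
Qed.
Lemma quot_scaleDl q : {morph quot_scale^~ q : a b / a + b}.
Proof.
move=> a b; rewrite -[q]quot_projK.
by rewrite !quot_scaleE scalerDl quot_projD.
Qed.
HB.instance Definition _ := GRing.Zmodule_isLmodule.Build k quotmod
  quot_scaleA quot_scale1 quot_scaleDr quot_scaleDl.

Lemma quot_proj_is_linear : linear quot_proj.
Proof. by move=> a x y; rewrite quot_projD -quot_scaleE. Qed.
HB.instance Definition _ :=
  GRing.isLinear.Build k V quotmod _ quot_proj quot_proj_is_linear.

Definition quot_lift (W : lmodType k) (f : {linear V -> W})
  (fS : forall x, x \in S -> f x = 0) (q : quotmod) : W := f (repr q).

Lemma quot_liftE (W : lmodType k) (f : {linear V -> W}) fS x :
  @quot_lift W f fS (quot_proj x) = f x.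
Proof.
apply/eqP; rewrite -subr_eq0 -linearB; apply/eqP/fS/quot_projP.
exact: quot_projK.
Qed.

Lemma quot_lift_is_linear (W : lmodType k) (f : {linear V -> W}) fS :
  linear (@quot_lift W f fS).
Proof.
move=> a q r; rewrite -[q]quot_projK -[r]quot_projK -linearP !quot_liftE.
exact: linearP.
Qed.
HB.instance Definition _ (W : lmodType k) (f : {linear V -> W}) fS :=
  GRing.isLinear.Build k quotmod W _ (@quot_lift W f fS)
    (@quot_lift_is_linear W f fS).

End QuotientModule.
Arguments quot_lift {k V S W f} fS q : simpl never.
Arguments quot_proj {k V} S x : simpl never.

Section FreeModule.
Variables (k : pzRingType) (K : choiceType).

Lemma finsupp_sub_closed : submod_closed (fun f : K -> k^o =>
  `[< finite_set [set x : K | f x != 0] >]).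
Proof.
split=> [|a f g]; rewrite !unfold_in.
  apply/asboolP; rewrite (_ : [set x | _] = set0) //.
  by apply/seteqP; split=> x //=; rewrite eqxx.
move=> /asboolP ff /asboolP gf; apply/asboolP.
apply: (@sub_finite_set _ _ ([set x | f x != 0] `|` [set x | g x != 0])).
  move=> x /=; case: (eqVneq (f x) 0) => [f0|]; last by left.
  case: (eqVneq (g x) 0) => [g0|]; last by right.
  have -> : (a *: f + g) x = a * f x + g x :> k by [].
  by rewrite f0 g0 mulr0 addr0 eqxx.
by rewrite finite_setU.
Qed.
Definition finsupp_sub := Submodule finsupp_sub_closed.

(* The free k-module k[K]: finitely supported functions K -> k. *)
Definition freemod := submod finsupp_sub.
HB.instance Definition _ := GRing.Lmodule.on freemod.

Lemma gen_subproof (x : K) : (fun y => (y == x)%:R : k^o) \in finsupp_sub.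
Proof.
rewrite unfold_in; apply/asboolP; apply: (@sub_finite_set _ _ [set x]).
  by move=> y /=; case: (y =P x) => // _; rewrite eqxx.
exact: finite_set1.
Qed.
Definition gen (x : K) : freemod := Submod (gen_subproof x).

Definition coef (f : freemod) (x : K) : k := val f x.

Lemma coef_gen x y : coef (gen x) y = (y == x)%:R.
Proof. by []. Qed.

Variables (V : lmodType k) (g : K -> V).
Definition free_lift (f : freemod) : V := \sum_(x \in [set: K]) coef f x *: g x.

Lemma free_lift_seq (f : freemod) (s : seq K) :
  uniq s -> (forall x, x \notin s -> coef f x = 0) ->
  free_lift f = \sum_(x <- s) coef f x *: g x.
Proof.
move=> us fs; rewrite /free_lift (@fsbigE _ _ _ _ _ s) //.
  by under eq_bigl do rewrite in_setT.
by move=> x _ xs; rewrite fs // scale0r.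
Qed.

Lemma free_supp (f : freemod) :
  exists2 s : seq K, uniq s & forall x, x \notin s -> coef f x = 0.
Proof.
have /asboolP/finite_seqP[s sE] : `[< finite_set [set x : K | coef f x != 0] >].
  exact: (submodP f).
exists (undup s) => [|x]; first exact: undup_uniq.
rewrite mem_undup => xs; apply/eqP; apply: contraNT xs => fx.
by have : [set` s] x by rewrite -sE.
Qed.

Lemma free_lift_is_linear : linear free_lift.
Proof.
move=> a f1 f2; case: (free_supp f1) => s1 _ h1; case: (free_supp f2) => s2 _ h2.
pose s := undup (s1 ++ s2).
have us : uniq s by exact: undup_uniq.
have k1 x : x \notin s -> coef f1 x = 0.
  by rewrite mem_undup mem_cat negb_or => /andP[/h1].
have k2 x : x \notin s -> coef f2 x = 0.
  by rewrite mem_undup mem_cat negb_or => /andP[_ /h2].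
have fE x : coef (a *: f1 + f2) x = a * coef f1 x + coef f2 x by [].
rewrite !(@free_lift_seq _ s) // => [|x xs]; last first.
  by rewrite fE k1 // k2 // mulr0 addr0.
rewrite scaler_sumr -big_split; apply: eq_bigr => x _.
by rewrite fE scalerDl scalerA.
Qed.
HB.instance Definition _ :=
  GRing.isLinear.Build k freemod V _ free_lift free_lift_is_linear.

Lemma free_lift_gen x : free_lift (gen x) = g x.
Proof.
rewrite (@free_lift_seq _ [:: x]) // => [|y]; rewrite /= ?inE.
  by rewrite big_seq1 coef_gen eqxx scale1r.
by rewrite coef_gen => /negPf ->.
Qed.

End FreeModule.
Arguments gen {k K} x : simpl never.
Arguments free_lift {k K V} g f : simpl never.

Lemma free_ext (k : pzRingType) (K : choiceType) (V : lmodType k)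
    (h1 h2 : {linear freemod k K -> V}) :
  (forall x, h1 (gen x) = h2 (gen x)) -> h1 =1 h2.
Proof.
move=> h12 f; case: (free_supp f) => s us fs.
have -> : f = \sum_(x <- s) coef f x *: gen x.
  apply: val_inj; apply/funext => y.
  rewrite -[RHS]/(coef (\sum_(x <- s) coef f x *: gen x) y) -[LHS]/(coef f y).
  have cD : {morph (fun h : freemod k K => coef h y) : a b / a + b} by [].
  have c0 : coef (0 : freemod k K) y = 0 :> k by [].
  rewrite (big_morph (fun h : freemod k K => coef h y) cD c0).
  have cZ x : coef (coef f x *: gen x) y = coef f x * (y == x)%:R :> k by [].
  under eq_bigr do rewrite cZ.
  case: (boolP (y \in s)) => [ys|/[dup] ys /fs fy].
    rewrite (bigD1_seq y) //= eqxx mulr1 big1 ?addr0 // => x xy.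
    by rewrite eq_sym (negPf xy) mulr0.
  rewrite fy big_seq big1 // => x xs /=.
  by case: eqP => [yx|]; rewrite ?mulr0 //; rewrite yx xs in ys.
by rewrite !linear_sum; apply: eq_bigr => x _; rewrite !linearZ /= h12.
Qed.

Record category := Category {
  obj :> choiceType;
  hom : obj -> obj -> choiceType;
  idm : forall a, hom a a;
  cmp : forall a b c, hom b c -> hom a b -> hom a c;
  cmp1m : forall a b (f : hom a b), cmp (idm b) f = f;
  cmpm1 : forall a b (f : hom a b), cmp f (idm a) = f;
  cmpA : forall a b c d (h : hom c d) (g : hom b c) (f : hom a b),
    cmp h (cmp g f) = cmp (cmp h g) f }.
Arguments hom {_} a b.
Arguments idm {_} a.
Arguments cmp {_ _ _ _} g f.

Definition opposite (C : category) : category :=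
  @Category (obj C) (fun a b => @hom C b a) (@idm C)
    (fun a b c g f => cmp f g)
    (fun a b f => cmpm1 f) (fun a b f => cmp1m f)
    (fun a b c d h g f => esym (cmpA f g h)).

Record cfunctor (C D : category) := CFunctor {
  cobj :> C -> D;
  cmap : forall a b, hom a b -> hom (cobj a) (cobj b);
  cmap1 : forall a, cmap (idm a) = idm (cobj a);
  cmapM : forall a b c (g : hom b c) (f : hom a b),
    cmap (cmp g f) = cmp (cmap g) (cmap f) }.
Arguments cmap {C D} _ {a b} f.

Definition cfunctor_op C D (H : cfunctor C D) :
    cfunctor (opposite C) (opposite D) :=
  @CFunctor (opposite C) (opposite D) H (fun a b f => @cmap C D H b a f)
    (cmap1 H) (fun a b c g f => cmapM H f g).

Section ModuleFunctors.
Variable k : comPzRingType.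

Record kfunctor (C : category) := KFunctor {
  kobj :> C -> lmodType k;
  kmap : forall a b, hom a b -> {linear kobj a -> kobj b};
  kmap1 : forall a x, kmap (idm a) x = x;
  kmapM : forall a b c (g : hom b c) (f : hom a b) x,
    kmap (cmp g f) x = kmap g (kmap f x) }.

Definition contrafunctor (C : category) := kfunctor (opposite C).

Record kmor (C : category) (X Y : kfunctor C) := KMor {
  kapp :> forall a, {linear X a -> Y a};
  kappN : forall a b (f : hom a b) x, kapp b (kmap X f x) = kmap Y f (kapp a x) }.

Definition precomp (C D : category) (H : cfunctor C D) (X : kfunctor D) :
    kfunctor C :=
  @KFunctor C (fun a => X (H a)) (fun a b f => kmap X (cmap H f))
    (fun a x => etrans (congr1 (fun f => kmap X f x) (cmap1 H a)) (kmap1 x))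
    (fun a b c g f x =>
       etrans (congr1 (fun f => kmap X f x) (cmapM H g f)) (kmapM _ _ x)).

Program Definition kmor_comp (C : category) (X Y Z : kfunctor C)
    (q : kmor Y Z) (p : kmor X Y) : kmor X Z :=
  @KMor C X Z (fun a => q a \o p a) _.
Next Obligation. by rewrite !kappN. Qed.

Section Kernels.
Variables (C : category) (X Y : kfunctor C) (p : kmor X Y).

Lemma ker_kmap_subproof a b (f : hom a b) (x : submod (ker_sub (p a))) :
  (kmap X f \o @submod_incl _ _ _) x \in ker_sub (p b).
Proof.
have px : p a (val x) = 0 by exact/eqP/(submodP x).
by apply/eqP; rewrite /= kappN px linear0.
Qed.

Program Definition kernel : kfunctor C :=
  @KFunctor C (fun a => submod (ker_sub (p a)))
    (fun a b f => submod_corestr (@ker_kmap_subproof a b f)) _ _.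
Next Obligation. by apply: val_inj; rewrite /= kmap1. Qed.
Next Obligation. by apply: val_inj; rewrite /= kmapM. Qed.

Definition kernel_incl : kmor kernel X :=
  @KMor C kernel X (fun a => @submod_incl _ _ _) (fun a b f x => erefl).

Lemma coker_kmap_subproof a b (f : hom a b) (y : Y a) :
  y \in img_sub (p a) -> (@quot_proj _ _ (img_sub (p b)) \o kmap Y f) y = 0.
Proof.
move=> /asboolP[x <-] /=; rewrite -kappN -(linear0 (@quot_proj _ _ _)).
by apply/quot_projP; rewrite subr0; apply/asboolP; exists (kmap X f x).
Qed.

Program Definition cokernel : kfunctor C :=
  @KFunctor C (fun a => quotmod (img_sub (p a)))
    (fun a b f => quot_lift (@coker_kmap_subproof a b f)) _ _.
Next Obligation. by rewrite -[x]quot_projK /= quot_liftE /= kmap1. Qed.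
Next Obligation. by rewrite -[x]quot_projK /= !quot_liftE /= kmapM. Qed.

End Kernels.

Program Definition representable (C : category) (a : C) : kfunctor C :=
  @KFunctor C (fun b => freemod k (hom a b))
    (fun b c f => free_lift (fun g : hom a b => gen (cmp f g))) _ _.
Next Obligation.
rewrite -[RHS]/(idfun x); apply: free_ext x => g /=.
by rewrite free_lift_gen cmp1m.
Qed.
Next Obligation.
rewrite -[RHS]/((free_lift _ \o free_lift _) x); apply: free_ext x => h /=.
by rewrite !free_lift_gen cmpA.
Qed.

Definition projective (C : category) (P : kfunctor C) : Prop :=
  forall (X Y : kfunctor C) (p : kmor X Y) (f : kmor P Y),
    (forall a (y : Y a), exists x, p a x = y) ->
    exists g : kmor P X, forall a x, p a (g a x) = f a x.

Record proj_resolution (C : category) (X : kfunctor C) := ProjResolution {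
  res_obj : nat -> kfunctor C;
  res_d : forall n, kmor (res_obj n.+1) (res_obj n);
  res_aug : kmor (res_obj 0) X;
  res_projective : forall n, projective (res_obj n);
  res_aug_surj : forall a (x : X a), exists y, res_aug a y = x;
  res_exact0 : forall a x, res_aug a x = 0 <-> exists y, res_d 0 a y = x;
  res_exactS : forall n a x,
    res_d n a x = 0 <-> exists y, res_d n.+1 a y = x }.

Section FreeResolution.
Variable C : category.
Implicit Type X : kfunctor C.

Program Definition free_cover X : kfunctor C :=
  @KFunctor C (fun b => freemod k {a : C & (X a * hom a b)%type})
    (fun b c f => free_lift (fun u : {a : C & (X a * hom a b)%type} =>
       gen (existT (fun a => (X a * hom a c)%type) (tag u)
             ((tagged u).1, cmp f (tagged u).2)))) _ _.
Next Obligation.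
rewrite -[RHS]/(idfun x); apply: free_ext x => -[c [y g]] /=.
by rewrite free_lift_gen /= cmp1m.
Qed.
Next Obligation.
rewrite -[RHS]/((free_lift _ \o free_lift _) x).
apply: free_ext x => -[e [y h]] /=.
by rewrite !free_lift_gen /= cmpA.
Qed.

Program Definition free_cover_aug X : kmor (free_cover X) X :=
  @KMor C (free_cover X) X
    (fun b => free_lift (fun u : {a : C & (X a * hom a b)%type} =>
       kmap X (tagged u).2 (tagged u).1)) _.
Next Obligation.
rewrite -[LHS]/((free_lift _ \o free_lift _) x) -[RHS]/((kmap X f \o free_lift _) x).
apply: free_ext x => -[c [y g]] /=.
by rewrite !free_lift_gen /= kmapM.
Qed.

Lemma free_cover_aug_surj X a (x : X a) : exists y, free_cover_aug X a y = x.
Proof.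
exists (gen (existT (fun c => (X c * hom c a)%type) a (x, idm a))).
by rewrite /= free_lift_gen /= kmap1.
Qed.

Lemma free_cover_projective X : projective (free_cover X).
Proof.
move=> Y Z p f p_surj.
pose e a (x : X a) : free_cover X a := gen (existT (fun c => (X c * hom c a)%type) a (x, idm a)).
pose l a (x : X a) : Y a := sval (cid (p_surj a (f a (e a x)))).
have lE a x : p a (l a x) = f a (e a x) by rewrite /l; case: cid.
pose g b : {linear free_cover X b -> Y b} :=
  free_lift (fun u : {a : C & (X a * hom a b)%type} =>
    kmap Y (tagged u).2 (l _ (tagged u).1)).
have gN a b (h : hom a b) x : g b (kmap (free_cover X) h x) = kmap Y h (g a x).
  rewrite -[LHS]/((g b \o kmap (free_cover X) h) x) -[RHS]/((kmap Y h \o g a) x).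
  apply: free_ext x => -[c [y i]] /=.
  by rewrite !free_lift_gen /= kmapM.
exists (KMor gN) => a x.
rewrite -[LHS]/((p a \o g a) x); apply: free_ext x => -[c [y i]] /=.
rewrite free_lift_gen /= kappN lE -kappN /= free_lift_gen /=.
by rewrite cmpm1.
Qed.

Fixpoint syzygy X (n : nat) : kfunctor C :=
  if n is m.+1 then kernel (free_cover_aug (syzygy X m)) else X.

Definition free_res_d X n :
    kmor (free_cover (syzygy X n.+1)) (free_cover (syzygy X n)) :=
  kmor_comp (kernel_incl (free_cover_aug (syzygy X n)))
            (free_cover_aug (syzygy X n.+1)).

Lemma free_res_step X a x :
  free_cover_aug X a x = 0 <->
  exists y, kmor_comp (kernel_incl (free_cover_aug X))
              (free_cover_aug (kernel (free_cover_aug X))) a y = x.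
Proof.
split=> [/eqP xK|[y <-]].
  have [y yx] := free_cover_aug_surj
    (@Submod _ _ (ker_sub (free_cover_aug X a)) x xK : kernel (free_cover_aug X) a).
  by exists y; rewrite -[LHS]/(submod_incl (free_cover_aug _ a y)) yx.
exact/eqP/(submodP (free_cover_aug (kernel (free_cover_aug X)) a y)).
Qed.

Lemma free_res_exactS X n a x :
  free_res_d X n a x = 0 <-> exists y, free_res_d X n.+1 a y = x.
Proof.
apply: (iff_trans _ (@free_res_step (syzygy X n.+1) a x)).
split=> dx; first exact: val_inj.
by rewrite -[LHS]/(submod_incl (free_cover_aug (syzygy X n.+1) a x)) dx.
Qed.

Definition free_resolution X : proj_resolution X :=
  @ProjResolution C X (fun n => free_cover (syzygy X n)) (free_res_d X)
    (free_cover_aug X) (fun n => @free_cover_projective _)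
    (@free_cover_aug_surj X) (@free_res_step X) (@free_res_exactS X).

End FreeResolution.

Record chain_complex := ChainComplex {
  cx_obj :> nat -> lmodType k;
  cx_d : forall n, {linear cx_obj n.+1 -> cx_obj n};
  cx_dd : forall n x, cx_d n (cx_d n.+1 x) = 0 }.

Definition cycles (X : chain_complex) (n : nat) : submodule (X n) :=
  match n return submodule (X n) with
  | 0 => full_sub (X 0)
  | m.+1 => ker_sub (cx_d X m)
  end.

Definition boundaries (X : chain_complex) (n : nat) :
    submodule (submod (cycles X n)) :=
  pre_sub (@submod_incl _ _ (cycles X n)) (img_sub (cx_d X n)).

Definition homology (X : chain_complex) (n : nat) : lmodType k :=
  quotmod (boundaries X n).

Lemma span_sub_gen (V : lmodType k) (A : set V) x : A x -> x \in span_sub A.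
Proof. by move=> Ax; apply/asboolP => S; apply. Qed.

Lemma span_sub_ker (V W : lmodType k) (A : set V) (h : {linear V -> W}) :
  (forall x, A x -> h x = 0) -> forall x, x \in span_sub A -> h x = 0.
Proof.
move=> hA x /asboolP/(_ (ker_sub h)) xA.
by apply/eqP/xA => y /hA hy; apply/eqP.
Qed.

Section Tensor.
Variables (C : category) (T : contrafunctor C) (G : kfunctor C).

Definition tensor_index : choiceType := {a : C & (T a * G a)%type}.

Definition elt (a : C) (x : T a) (y : G a) : freemod k tensor_index :=
  gen (existT (fun a : C => (T a * G a)%type) a (x, y)).

Inductive tensor_rel : freemod k tensor_index -> Prop :=
| TensorDl a x1 x2 y :
    tensor_rel (elt (a := a) (x1 + x2) y - (elt x1 y + elt x2 y))
| TensorDr a x y1 y2 :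
    tensor_rel (elt (a := a) x (y1 + y2) - (elt x y1 + elt x y2))
| TensorZl a c x y : tensor_rel (elt (a := a) (c *: x) y - c *: elt x y)
| TensorZr a c x y : tensor_rel (elt (a := a) x (c *: y) - c *: elt x y)
| TensorHom (a b : C) (f : hom a b) (x : T b) (y : G a) :
    tensor_rel (elt (@kmap _ T b a f x) y - elt x (kmap G f y)).

(* The coend of (a, b) |-> T a (x)_k G b, presented by generators x (x) y with
   x in T a, y in G a. *)
Definition tensor : lmodType k := quotmod (span_sub tensor_rel).

Definition pure (a : C) (x : T a) (y : G a) : tensor :=
  quot_proj (span_sub tensor_rel) (elt x y).

Lemma pure_rel u v : tensor_rel (u - v) ->
  quot_proj (span_sub tensor_rel) u = quot_proj (span_sub tensor_rel) v.
Proof. by move=> uv; apply/quot_projP; apply: span_sub_gen. Qed.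

Lemma pureDl (a : C) (x1 x2 : T a) (y : G a) :
  pure (x1 + x2) y = pure x1 y + pure x2 y.
Proof. by rewrite /pure -linearD; apply: pure_rel; exact: (@TensorDl a x1 x2 y). Qed.

Lemma pureDr (a : C) (x : T a) (y1 y2 : G a) :
  pure x (y1 + y2) = pure x y1 + pure x y2.
Proof. by rewrite /pure -linearD; apply: pure_rel; exact: (@TensorDr a x y1 y2). Qed.

Lemma pureZl (a : C) c (x : T a) (y : G a) : pure (c *: x) y = c *: pure x y.
Proof. by rewrite /pure -linearZ; apply: pure_rel; exact: (@TensorZl a c x y). Qed.

Lemma pure0l (a : C) (y : G a) : pure (0 : T a) y = 0.
Proof. by have := pureZl 0 0 y; rewrite !scale0r. Qed.

Lemma pureZr (a : C) c (x : T a) (y : G a) : pure x (c *: y) = c *: pure x y.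
Proof. by rewrite /pure -linearZ; apply: pure_rel; exact: (@TensorZr a c x y). Qed.

Lemma pure_hom (a b : C) (f : hom a b) (x : T b) (y : G a) :
  pure (@kmap _ T b a f x) y = pure x (kmap G f y).
Proof. by apply: pure_rel; exact: (@TensorHom a b f x y). Qed.

End Tensor.

Section TensorMap.
Variables (C : category) (T T' : contrafunctor C) (G : kfunctor C).
Variable p : kmor T T'.

Definition tensor_map_free : {linear freemod k (tensor_index T G) -> tensor T' G} :=
  free_lift (fun u : tensor_index T G => pure (p _ (tagged u).1) (tagged u).2).

Lemma tensor_map_freeE (a : C) (x : T a) (y : G a) :
  tensor_map_free (elt x y) = pure (p a x) y.
Proof. exact: free_lift_gen. Qed.

Lemma tensor_map_subproof u : u \in span_sub (@tensor_rel C T G) ->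
  tensor_map_free u = 0.
Proof.
move: u; apply: span_sub_ker => u; case=> [a x1 x2 y|a x y1 y2|a c x y|a c x y|a b f x y].
- by rewrite linearB linearD !tensor_map_freeE linearD pureDl subrr.
- by rewrite linearB linearD !tensor_map_freeE pureDr subrr.
- by rewrite linearB linearZ /= !tensor_map_freeE linearZ /= pureZl subrr.
- by rewrite linearB linearZ /= !tensor_map_freeE pureZr subrr.
- by rewrite linearB !tensor_map_freeE kappN pure_hom subrr.
Qed.

Definition tensor_map : {linear tensor T G -> tensor T' G} :=
  quot_lift tensor_map_subproof.

Lemma tensor_map_pure (a : C) (x : T a) (y : G a) :
  tensor_map (pure x y) = pure (p a x) y.
Proof. by rewrite /tensor_map /pure /= quot_liftE tensor_map_freeE. Qed.

End TensorMap.

Lemma tensor_ext C (T : contrafunctor C) (G : kfunctor C) (W : lmodType k)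
    (h1 h2 : {linear tensor T G -> W}) :
  (forall (a : C) (x : T a) (y : G a), h1 (pure x y) = h2 (pure x y)) -> h1 =1 h2.
Proof.
move=> h12 q; rewrite -[q]quot_projK.
rewrite -[LHS]/((h1 \o quot_proj _) _) -[RHS]/((h2 \o quot_proj _) _).
by apply: free_ext => -[a [x y]]; exact: h12.
Qed.

Section Tor.
Variables (C : category) (T : contrafunctor C) (G : kfunctor C).

Lemma tensor_dd (P : proj_resolution T) n x :
  tensor_map G (res_d P n) (tensor_map G (res_d P n.+1) x) = 0.
Proof.
rewrite -[LHS]/((tensor_map G (res_d P n) \o tensor_map G (res_d P n.+1)) x).
rewrite -[RHS]/(\0 x); apply: tensor_ext x => a x y /=.
rewrite !tensor_map_pure (_ : res_d P n a _ = 0); last first.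
  by apply/res_exactS; exists x.
exact: pure0l.
Qed.

Definition tensor_complex (P : proj_resolution T) : chain_complex :=
  @ChainComplex (fun n => tensor (res_obj P n) G)
    (fun n => tensor_map G (res_d P n)) (@tensor_dd P).

End Tor.

(* The left derived functors of - (x) G at T, computed from the projective
   resolution of T obtained by repeatedly covering by free functors. *)
Definition Tor (C : category) (n : nat) (T : contrafunctor C) (G : kfunctor C) :
    lmodType k :=
  homology (tensor_complex G (free_resolution T)) n.

End ModuleFunctors.

Definition lmod_isomorphic (k : pzRingType) (V W : lmodType k) : Prop :=
  exists f : {linear V -> W}, bijective f.

Definition fin_hom (m n : nat) := {ffun 'I_m.+1 -> 'I_n.+1}.

Definition fin_id n : fin_hom n n := [ffun i => i].
Definition fin_cmp m n p (g : fin_hom n p) (f : fin_hom m n) : fin_hom m p :=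
  [ffun i => g (f i)].

Program Definition Fin : category :=
  @Category nat fin_hom fin_id fin_cmp _ _ _.
Next Obligation. by apply/ffunP => i; rewrite !ffunE. Qed.
Next Obligation. by apply/ffunP => i; rewrite !ffunE. Qed.
Next Obligation. by apply/ffunP => i; rewrite !ffunE. Qed.

Definition gamma_hom (m n : nat) := {f : fin_hom m n | f ord0 == ord0}.

Lemma gamma_id_subproof n : fin_id n ord0 == ord0.
Proof. by rewrite ffunE. Qed.
Lemma gamma_cmp_subproof m n p (g : gamma_hom n p) (f : gamma_hom m n) :
  fin_cmp (val g) (val f) ord0 == ord0.
Proof. by rewrite ffunE (eqP (valP f)) (valP g). Qed.

Program Definition Gamma : category :=
  @Category nat gamma_hom (fun n => exist _ (fin_id n) (gamma_id_subproof n))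
    (fun m n p g f => exist _ (fin_cmp (val g) (val f)) (gamma_cmp_subproof g f))
    _ _ _.
Next Obligation. by apply: val_inj; apply: (@cmp1m Fin). Qed.
Next Obligation. by apply: val_inj; apply: (@cmpm1 Fin). Qed.
Next Obligation. by apply: val_inj; apply: (@cmpA Fin). Qed.

Definition mu : cfunctor Gamma Fin :=
  @CFunctor Gamma Fin (fun n => n) (fun m n f => val f)
    (fun n => erefl) (fun m n p g f => erefl).

(* ord0 is the added basepoint and [lift ord0] the inclusion j |-> j + 1. *)
Definition nu_map m n (f : fin_hom m n) : fin_hom m.+1 n.+1 :=
  [ffun i => if unlift ord0 i is Some j then lift ord0 (f j) else ord0].

Lemma nu_map_subproof m n (f : fin_hom m n) : nu_map f ord0 == ord0.
Proof. by rewrite ffunE unlift_none. Qed.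

Program Definition nu : cfunctor Fin Gamma :=
  @CFunctor Fin Gamma (fun n => n.+1)
    (fun m n f => exist _ (nu_map f) (nu_map_subproof f)) _ _.
Next Obligation.
apply: val_inj; apply/ffunP => i; rewrite !ffunE.
by case: unliftP => [j ->|->//]; rewrite ffunE.
Qed.
Next Obligation.
apply: val_inj; apply/ffunP => i; rewrite !ffunE.
by case: unliftP => [j _|_]; rewrite ?liftK ?unlift_none // ffunE.
Qed.

Section GammaHomology.
Variable k : comPzRingType.

Lemma pointed_closed n : submod_closed (fun u : 'I_n.+1 -> k^o => u ord0 == 0).
Proof.
split=> [|a u v]; rewrite !unfold_in ?eqxx // => /eqP u0 /eqP v0.
have -> : (a *: u + v) ord0 = a * u ord0 + v ord0 :> k by [].
by rewrite u0 v0 mulr0 addr0.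
Qed.
Definition pointed n : submodule ('I_n.+1 -> k^o) := Submodule (@pointed_closed n).

Definition pull m n (f : fin_hom m n) (u : 'I_n.+1 -> k^o) : 'I_m.+1 -> k^o :=
  fun i => u (f i).
Lemma pull_is_linear m n (f : fin_hom m n) : linear (pull f).
Proof. by []. Qed.
HB.instance Definition _ m n (f : fin_hom m n) :=
  GRing.isLinear.Build k ('I_n.+1 -> k^o) ('I_m.+1 -> k^o) _ (pull f)
    (pull_is_linear f).

Lemma pull_pointed m n (f : gamma_hom m n) (u : submod (pointed n)) :
  (pull (val f) \o @submod_incl _ _ _) u \in pointed m.
Proof.
have u0 : val u ord0 = 0 by exact/eqP/(submodP u).
by apply/eqP; rewrite /= /pull (eqP (valP f)).
Qed.

Program Definition tfun : contrafunctor k Gamma :=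
  @KFunctor k (opposite Gamma) (fun n => submod (pointed n))
    (fun n m f => submod_corestr (pull_pointed f)) _ _.
Next Obligation.
by apply: val_inj; apply/funext => i; rewrite /= /pull ffunE.
Qed.
Next Obligation.
by apply: val_inj; apply/funext => i; rewrite /= /pull /= ffunE.
Qed.

Definition F0 : contrafunctor k Fin := @representable k (opposite Fin) 0%N.

Definition nu_t : contrafunctor k Fin := precomp (cfunctor_op nu) tfun.

Lemma one_off_base_subproof n : (fun i => (i != ord0)%:R) \in pointed n.
Proof. by apply/eqP; rewrite eqxx. Qed.
Definition one_off_base n : submod (pointed n) :=
  Submod (one_off_base_subproof n).

Program Definition F0_to_nu_t : kmor F0 nu_t :=
  @KMor k (opposite Fin) F0 nu_t
    (fun n => free_lift (fun _ : fin_hom n 0 => one_off_base n.+1)) _.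
Next Obligation.
rewrite -[LHS]/((free_lift _ \o free_lift _) x).
rewrite -[RHS]/((kmap nu_t f \o free_lift _) x); apply: free_ext x => g /=.
rewrite !free_lift_gen; apply: val_inj; apply/funext => i /=.
rewrite /pull /= ffunE; case: unliftP => [j ->|->].
  have nz l (h : 'I_l.+1) : (lift ord0 h != ord0)%:R = 1 :> k.
    by rewrite eq_sym neq_lift.
  exact: etrans (nz _ j) (esym (nz _ (f j))).
by [].
Qed.

(* Exactness of 0 -> F0 -> nu^* t. *)
Lemma F0_to_nu_t_inj n : injective (F0_to_nu_t n).
Proof.
pose e : fin_hom n 0 := [ffun=> ord0].
have hom1 (g : fin_hom n 0) : g = e.
  by apply/ffunP => i; rewrite !ord1.
have xE (x : F0 n) : x = coef x e *: gen e.
  apply: val_inj; apply/funext => g; rewrite (hom1 g).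
  rewrite -[RHS]/(coef x e * (e == e)%:R : k) eqxx mulr1 //.
move=> x y; rewrite (xE x) (xE y) !linearZ /= !free_lift_gen.
move=> /(congr1 (fun u : submod (pointed n.+1) => val u ord_max)).
by rewrite -[LHS]/(coef x e * 1 : k) -[RHS]/(coef y e * 1 : k) !mulr1 => ->.
Qed.

Definition tbar : contrafunctor k Fin := cokernel F0_to_nu_t.

Definition HGamma (n : nat) (G : kfunctor k Gamma) : lmodType k := Tor n tfun G.

Definition HGammaC (n : nat) (F : kfunctor k Fin) : lmodType k := Tor n tbar F.

End GammaHomology.

(* Main.v *)
(* Restriction along nu, being left adjoint on contravariant functors to
   restriction along mu, is exact, preserves projectives and satisfies
   nu^*T (x) F = T (x) mu^*F.  So if P is a projective resolution of t, then
   nu^*P is one of nu^*t, and nu^*P (x) F = P (x) mu^*F computes the Gamma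
   homology of mu^*F.  As F_0 is representable, hence projective, F_0 -> nu^*t
   lifts to F_0 -> nu^*P_0, and the mapping cone of this lift is a projective
   resolution of tbar which differs from nu^*P only in degree 1, by the summand
   F_0.  Since the component nu^*P_2 -> F_0 of the differential is 0, the
   homology of the two tensored complexes agrees in degrees > 1. *)
From HB Require Import structures.
From mathcomp Require Import all_boot all_order all_algebra.
From mathcomp Require Import boolp classical_sets.
Require Import Defs.

Set Implicit Arguments.
Unset Strict Implicit.
Unset Printing Implicit Defensive.

Import GRing.Theory.
Local Open Scope ring_scope.

(** * Isomorphisms on homology in a single degree *)

Section HomologyIsomorphism.
Variable k : comPzRingType.

Lemma lmod_isomorphic_trans (U V W : lmodType k) :
  lmod_isomorphic U V -> lmod_isomorphic V W -> lmod_isomorphic U W.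
Proof. by case=> f f_bij [g g_bij]; exists (g \o f); apply: bij_comp. Qed.

Section InducedMap.
Variables (X Y : chain_complex k) (n : nat) (f : {linear X n -> Y n}).
Hypothesis f_cycles : forall x, x \in cycles X n -> f x \in cycles Y n.
Hypothesis f_img : forall x, f (cx_d X n x) \in img_sub (cx_d Y n).

Lemma cycle_map_subproof (z : submod (cycles X n)) :
  (f \o @submod_incl _ _ _) z \in cycles Y n.
Proof. exact/f_cycles/submodP. Qed.

Definition cycle_map : {linear submod (cycles X n) -> submod (cycles Y n)} :=
  submod_corestr cycle_map_subproof.

Lemma homology_map_subproof z : z \in boundaries X n ->
  (quot_proj (boundaries Y n) \o cycle_map) z = 0.
Proof.
move=> /asboolP[x xz]; rewrite -(linear0 (quot_proj _)); apply/quot_projP.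
rewrite subr0 -[_ \in _]/(f (submod_incl z) \in img_sub (cx_d Y n)) -xz.
exact: f_img.
Qed.

Definition homology_map : {linear homology X n -> homology Y n} :=
  quot_lift homology_map_subproof.

Lemma homology_mapE z : homology_map (quot_proj (boundaries X n) z) =
  quot_proj (boundaries Y n) (cycle_map z).
Proof. exact: quot_liftE. Qed.

End InducedMap.

(** Homology in degree [n] sees only the cycles and boundaries there, so [f] and [g] are given in
    that degree alone. This makes it possible to compare complexes that differ elsewhere. *)
Lemma homology_iso (X Y : chain_complex k) n
    (f : {linear X n -> Y n}) (g : {linear Y n -> X n}) :
  (forall x, x \in cycles X n -> f x \in cycles Y n) ->
  (forall y, y \in cycles Y n -> g y \in cycles X n) ->
  (forall x, f (cx_d X n x) \in img_sub (cx_d Y n)) ->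
  (forall y, g (cx_d Y n y) \in img_sub (cx_d X n)) ->
  (forall x, x \in cycles X n -> g (f x) - x \in img_sub (cx_d X n)) ->
  (forall y, y \in cycles Y n -> f (g y) - y \in img_sub (cx_d Y n)) ->
  lmod_isomorphic (homology X n) (homology Y n).
Proof.
move=> fc gc fi gi gf fg; exists (homology_map fc fi).
exists (homology_map gc gi) => q; rewrite -[q]quot_projK !homology_mapE.
  exact/quot_projP/gf/submodP.
exact/quot_projP/fg/submodP.
Qed.

Lemma homology_iso_can (X Y : chain_complex k) n
    (f : {linear X n -> Y n}) (g : {linear Y n -> X n}) :
  (forall x, x \in cycles X n -> f x \in cycles Y n) ->
  (forall y, y \in cycles Y n -> g y \in cycles X n) ->
  (forall x, f (cx_d X n x) \in img_sub (cx_d Y n)) ->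
  (forall y, g (cx_d Y n y) \in img_sub (cx_d X n)) ->
  cancel f g -> cancel g f ->
  lmod_isomorphic (homology X n) (homology Y n).
Proof.
move=> fc gc fi gi fK gK.
by apply: (homology_iso fc gc) => // x _; rewrite (fK, gK) subrr rpred0.
Qed.

End HomologyIsomorphism.

(** * Morphisms of functors and lifting against exact sequences *)

Section KMorphisms.
Variables (k : comPzRingType) (C : category).
Implicit Types X Y Z P : kfunctor k C.

Lemma id_kmor_subproof X a b (f : hom a b) (x : X a) :
  idfun (kmap X f x) = kmap X f (idfun x).
Proof. by []. Qed.
Definition id_kmor X : kmor X X := KMor (@id_kmor_subproof X).

Lemma sub_kmor_subproof X Y (p q : kmor X Y) a b (f : hom a b) x :
  (p b \- q b) (kmap X f x) = kmap Y f ((p a \- q a) x).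
Proof. by rewrite /= !kappN linearB. Qed.
Definition sub_kmor X Y (p q : kmor X Y) : kmor X Y :=
  KMor (sub_kmor_subproof p q).
Lemma sub_kmorE X Y (p q : kmor X Y) a x : sub_kmor p q a x = p a x - q a x.
Proof. by []. Qed.

Lemma kernel_lift_in X Y Z (p : kmor Y Z) (f : kmor X Y)
  (pf : forall a x, p a (f a x) = 0) a x : f a x \in ker_sub (p a).
Proof. exact/eqP/pf. Qed.

Lemma kernel_lift_subproof X Y Z (p : kmor Y Z) (f : kmor X Y)
    (pf : forall a x, p a (f a x) = 0) a b (h : hom a b) x :
  submod_corestr (kernel_lift_in pf (a := b)) (kmap X h x) =
  kmap (kernel p) h (submod_corestr (kernel_lift_in pf (a := a)) x).
Proof. by apply: val_inj; rewrite /= kappN. Qed.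

Definition kernel_lift X Y Z (p : kmor Y Z) (f : kmor X Y)
    (pf : forall a x, p a (f a x) = 0) : kmor X (kernel p) :=
  @KMor k C X (kernel p) (fun a => submod_corestr (kernel_lift_in pf (a := a)))
    (kernel_lift_subproof pf).

(** By exactness [d] corestricts to a surjection onto the kernel of [e], and [f] takes values in
    that kernel; projectivity is applied to these corestrictions. *)
Lemma projective_lift X Y Z P (d : kmor X Y) (e : kmor Y Z) (f : kmor P Y) :
  projective P -> (forall a y, e a y = 0 <-> exists x, d a x = y) ->
  (forall a x, e a (f a x) = 0) ->
  exists g : kmor P X, forall a x, d a (g a x) = f a x.
Proof.
move=> projP exY ef0.
have ed0 a x : e a (d a x) = 0 by apply/exY; exists x.
have [a [y ey]|g gE] := projP _ _ (kernel_lift ed0) (kernel_lift ef0).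
  have [x xy] := (exY a y).1 (eqP ey).
  by exists x; apply: val_inj.
exists g => a x.
by have /(congr1 val) := gE a x.
Qed.

End KMorphisms.

(** * Comparison of projective resolutions: chain maps and homotopies *)

Section Comparison.
Variables (k : comPzRingType) (C : category) (X : kfunctor k C).
Implicit Types P Q : proj_resolution X.

Definition chain_map P Q (f : forall n, kmor (res_obj P n) (res_obj Q n)) :=
  (forall a x, res_aug Q a (f 0%N a x) = res_aug P a x) /\
  forall n a x, res_d Q n a (f n.+1 a x) = f n a (res_d P n a x).

Lemma res_aug_d P a x : res_aug P a (res_d P 0 a x) = 0.
Proof. by apply/res_exact0; exists x. Qed.

Lemma res_dd P n a x : res_d P n a (res_d P n.+1 a x) = 0.
Proof. by apply/res_exactS; exists x. Qed.

Lemma chain_map_exists P Q : exists f, @chain_map P Q f.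
Proof.
(* The next component exists only because the last square commutes, so the recursion carries two
   consecutive components together with their square. *)
pose step n := {u : kmor (res_obj P n) (res_obj Q n) *
                    kmor (res_obj P n.+1) (res_obj Q n.+1) |
  forall a x, res_d Q n a (u.2 a x) = u.1 a (res_d P n a x)}.
have [f0 f0E] := res_projective (res_aug P) (@res_aug_surj _ _ _ Q).
have [a x|f1 f1E] := projective_lift (f := kmor_comp f0 (res_d P 0))
  (@res_projective _ _ _ P 1) (@res_exact0 _ _ _ Q).
  by rewrite /= f0E res_aug_d.
(* The pairs overlap: the first entry of the new pair is the second entry of the old one. Choice
   ([cid]) turns existence of a lift into data, as the recursion requires. *)
have next n (u : step n) : {v : step n.+1 | (sval v).1 = (sval u).2}.
  case: u => -[g0 g1] /= gE.
  have [|g2 g2E] := cid (projective_lift (f := kmor_comp g1 (res_d P n.+1))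
    (@res_projective _ _ _ P n.+2) (@res_exactS _ _ _ Q n) _).
    by move=> a x; rewrite /= gE res_dd linear0.
  by exists (exist _ (g1, g2) g2E).
pose u := fix u n : step n :=
  if n is m.+1 then sval (next m (u m)) else exist _ (f0, f1) f1E.
have uE n : (sval (u n.+1)).1 = (sval (u n)).2 by rewrite /=; case: (next n _).
exists (fun n => (sval (u n)).1); split=> // n a x.
by rewrite uE (svalP (u n)).
Qed.

(** Only the two components around each degree are asserted, not one coherent family; homology in a
    fixed degree uses no more. The pair also serves as the induction hypothesis, since the identity
    for [h] and [h'] is what permits the next lift. *)
Lemma chain_homotopy P Q f g : @chain_map P Q f -> @chain_map P Q g ->
  (exists h : kmor (res_obj P 0) (res_obj Q 1),
     forall a x, f 0%N a x - g 0%N a x = res_d Q 0 a (h a x)) /\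
  forall n, exists (h : kmor (res_obj P n) (res_obj Q n.+1))
    (h' : kmor (res_obj P n.+1) (res_obj Q n.+2)), forall a x,
    f n.+1 a x - g n.+1 a x = res_d Q n.+1 a (h' a x) + h a (res_d P n a x).
Proof.
move=> [f0 fS] [g0 gS].
have [a x|h0 h0E] := projective_lift (f := sub_kmor (f 0%N) (g 0%N))
  (@res_projective _ _ _ P 0) (@res_exact0 _ _ _ Q).
  by rewrite sub_kmorE linearB f0 g0 subrr.
split; first by exists h0 => a x; rewrite h0E.
(* The premise says exactly that the difference of [f] and [g] in degree [n.+1], minus [h] after the
   differential, is killed by the differential of [Q]; it therefore lifts to [h']. *)
have next n (h : kmor (res_obj P n) (res_obj Q n.+1)) :
    (forall a x, res_d Q n a (h a (res_d P n a x)) =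
       f n a (res_d P n a x) - g n a (res_d P n a x)) ->
    exists h' : kmor (res_obj P n.+1) (res_obj Q n.+2), forall a x,
      f n.+1 a x - g n.+1 a x = res_d Q n.+1 a (h' a x) + h a (res_d P n a x).
  move=> hE; have [a x|h' h'E] := projective_lift
    (f := sub_kmor (sub_kmor (f n.+1) (g n.+1)) (kmor_comp h (res_d P n)))
    (@res_projective _ _ _ P n.+1) (@res_exactS _ _ _ Q n).
    by rewrite !sub_kmorE !linearB fS gS hE subrr.
  by exists h' => a x; rewrite h'E !sub_kmorE subrK.
elim=> [|n [h [h' hE]]].
  have [|h1 h1E] := next 0%N h0; last by exists h0, h1.
  by move=> a x; rewrite h0E.
have [|h'' h''E] := next n.+1 h'; last by exists h', h''.
by move=> a x; rewrite hE res_dd linear0 addr0.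
Qed.

End Comparison.

(** * Independence of Tor from the chosen resolution *)

Section TensorComplex.
Variables (k : comPzRingType) (C : category) (T : contrafunctor k C).
Variable G : kfunctor k C.

Lemma tensor_map_eqfun (U V : contrafunctor k C) (p q : kmor U V) z :
  (forall a x, p a x = q a x) -> tensor_map G p z = tensor_map G q z.
Proof.
by move=> pq; apply: tensor_ext z => a x y; rewrite !tensor_map_pure pq.
Qed.

Lemma tensor_map_comp (U V W : contrafunctor k C) (q : kmor V W)
    (p : kmor U V) z :
  tensor_map G (kmor_comp q p) z = tensor_map G q (tensor_map G p z).
Proof.
rewrite -[RHS]/((tensor_map G q \o tensor_map G p) z).
by apply: tensor_ext z => a x y /=; rewrite !tensor_map_pure.
Qed.

Lemma tensor_chain_map (P Q : proj_resolution T) f n z :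
  @chain_map _ _ _ P Q f ->
  tensor_map G (res_d Q n) (tensor_map G (f n.+1) z) =
  tensor_map G (f n) (tensor_map G (res_d P n) z).
Proof.
move=> [_ fS]; rewrite -!tensor_map_comp.
by apply: tensor_map_eqfun => a x /=; rewrite fS.
Qed.

Lemma pureBl (U : contrafunctor k C) (a : C) (x1 x2 : U a) (y : G a) :
  pure (x1 - x2) y = pure x1 y - pure x2 y.
Proof. by rewrite pureDl -scaleN1r pureZl scaleN1r. Qed.

Lemma tensor_chain_homotopy (P : proj_resolution T) f n z :
  @chain_map _ _ _ P P f -> z \in cycles (tensor_complex G P) n ->
  tensor_map G (f n) z - z \in img_sub (cx_d (tensor_complex G P) n).
Proof.
move=> cf zc.
have id_chain : chain_map (fun n => id_kmor (res_obj P n)) by [].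
have [[h hE] hS] := chain_homotopy cf id_chain.
case: n z zc => [z _|n z /eqP zc].
  apply/asboolP; exists (tensor_map G h z).
  rewrite -[LHS]/((tensor_map G (res_d P 0) \o tensor_map G h) z).
  rewrite -[RHS]/((tensor_map G (f 0%N) \- idfun) z).
  apply: tensor_ext z => a x y /=.
  by rewrite !tensor_map_pure -pureBl -hE.
have [h1 [h2 h12]] := hS n.
apply/asboolP; exists (tensor_map G h2 z).
(* The term [h1] of the differential of [z] vanishes because [z] is a cycle. Adding it gives an
   identity of linear maps valid on every tensor, which can then be checked on pure ones. *)
rewrite -[LHS]addr0 -(linear0 (tensor_map G h1)) -[in LHS]zc.
rewrite -[LHS]/(((tensor_map G (res_d P n.+1) \o tensor_map G h2) \+
                 (tensor_map G h1 \o tensor_map G (res_d P n))) z).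
rewrite -[RHS]/((tensor_map G (f n.+1) \- idfun) z).
move: z {zc}; apply: tensor_ext => a x y /=.
by rewrite !tensor_map_pure -pureDl -pureBl -h12.
Qed.

(** Chain maps over [T] exist in both directions, and each composite is homotopic to the identity by
    comparison of self-maps of one resolution. *)
Theorem tensor_homology_unique (P Q : proj_resolution T) n : lmod_isomorphic
  (homology (tensor_complex G P) n) (homology (tensor_complex G Q) n).
Proof.
have [f cf] := chain_map_exists P Q; have [g cg] := chain_map_exists Q P.
have cgf : @chain_map _ _ _ P P (fun n => kmor_comp (g n) (f n)).
  by split=> [a x|m a x] /=; rewrite ?cg.1 ?cf.1 ?cg.2 ?cf.2.
have cfg : @chain_map _ _ _ Q Q (fun n => kmor_comp (f n) (g n)).
  by split=> [a x|m a x] /=; rewrite ?cf.1 ?cg.1 ?cf.2 ?cg.2.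
have chain_cycles (R S : proj_resolution T)
      (h : forall n, kmor (res_obj R n) (res_obj S n)) z :
    chain_map h -> z \in cycles (tensor_complex G R) n ->
    tensor_map G (h n) z \in cycles (tensor_complex G S) n.
  move=> ch; case: n z => [//|m] z /eqP zc; apply/eqP.
  rewrite -[LHS]/(tensor_map G (res_d S m) (tensor_map G (h m.+1) z)).
  rewrite tensor_chain_map //.
  by rewrite [tensor_map G (res_d R m) z]zc linear0.
have chain_img (R S : proj_resolution T)
      (h : forall n, kmor (res_obj R n) (res_obj S n)) z :
    chain_map h -> tensor_map G (h n) (cx_d (tensor_complex G R) n z)
      \in img_sub (cx_d (tensor_complex G S) n).
  move=> ch; apply/asboolP; exists (tensor_map G (h n.+1) z).
  exact: tensor_chain_map.
apply: (@homology_iso k (tensor_complex G P) (tensor_complex G Q) n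
  (tensor_map G (f n)) (tensor_map G (g n))).
- by move=> z; apply: chain_cycles.
- by move=> z; apply: chain_cycles.
- by move=> z; apply: chain_img.
- by move=> z; apply: chain_img.
- by move=> z zc; rewrite -tensor_map_comp;
  exact: (tensor_chain_homotopy cgf zc).
- by move=> z zc; rewrite -tensor_map_comp;
  exact: (tensor_chain_homotopy cfg zc).
Qed.

End TensorComplex.

(** * Direct sums of functors *)

Section DirectSum.
Variables (k : comPzRingType) (C : category).
Implicit Types X Y Z : kfunctor k C.

Section DirectSumFunctor.
Variables X Y : kfunctor k C.

Definition dsum_map a b (f : hom a b) (u : X a * Y a) : X b * Y b :=
  (kmap X f u.1, kmap Y f u.2).

Lemma dsum_map_is_linear a b (f : hom a b) : linear (dsum_map f).
Proof. by move=> c u v; rewrite /dsum_map !linearP. Qed.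
HB.instance Definition _ a b (f : hom a b) :=
  GRing.isLinear.Build k (X a * Y a)%type (X b * Y b)%type _ (dsum_map f)
    (dsum_map_is_linear f).

Lemma dsum_map1 a u : dsum_map (idm a) u = u.
Proof. by case: u => x y; rewrite /dsum_map !kmap1. Qed.
Lemma dsum_mapM a b c (g : hom b c) (f : hom a b) u :
  dsum_map (cmp g f) u = dsum_map g (dsum_map f u).
Proof. by rewrite /dsum_map !kmapM. Qed.
Definition dsum : kfunctor k C :=
  @KFunctor k C (fun a => (X a * Y a)%type)
    (fun a b (f : hom a b) => dsum_map f) dsum_map1 dsum_mapM.

Definition inj1 a (x : X a) : X a * Y a := (x, 0).
Lemma inj1_is_linear a : linear (@inj1 a).
Proof. by move=> c x y; congr pair; rewrite /= scaler0 addr0. Qed.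
HB.instance Definition _ a :=
  GRing.isLinear.Build k (X a) (X a * Y a)%type _ (@inj1 a) (@inj1_is_linear a).
Lemma inj1N a b (f : hom a b) x : inj1 (kmap X f x) = kmap dsum f (inj1 x).
Proof. by congr pair; rewrite /= linear0. Qed.
Definition dsum_inj1 : kmor X dsum := @KMor k C X dsum (fun a => @inj1 a) inj1N.

Definition inj2 a (y : Y a) : X a * Y a := (0, y).
Lemma inj2_is_linear a : linear (@inj2 a).
Proof. by move=> c x y; congr pair; rewrite /= scaler0 addr0. Qed.
HB.instance Definition _ a :=
  GRing.isLinear.Build k (Y a) (X a * Y a)%type _ (@inj2 a) (@inj2_is_linear a).
Lemma inj2N a b (f : hom a b) y : inj2 (kmap Y f y) = kmap dsum f (inj2 y).
Proof. by congr pair; rewrite /= linear0. Qed.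
Definition dsum_inj2 : kmor Y dsum := @KMor k C Y dsum (fun a => @inj2 a) inj2N.

Variables (Z : kfunctor k C) (p : kmor X Z) (q : kmor Y Z).

Definition copair a (u : X a * Y a) : Z a := p a u.1 + q a u.2.
Lemma copair_is_linear a : linear (@copair a).
Proof.
move=> c u v; rewrite /copair !linearP scalerDr.
by rewrite addrACA.
Qed.
HB.instance Definition _ a :=
  GRing.isLinear.Build k (X a * Y a)%type (Z a) _ (@copair a)
    (@copair_is_linear a).
Lemma copairN a b (f : hom a b) u :
  copair (kmap dsum f u) = kmap Z f (copair u).
Proof. by rewrite /copair /= !kappN linearD. Qed.
Definition dsum_copair : kmor dsum Z :=
  @KMor k C dsum Z (fun a => @copair a) copairN.

End DirectSumFunctor.

Lemma dsum_projective X Y :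
  projective X -> projective Y -> projective (dsum X Y).
Proof.
move=> projX projY V W p f p_surj.
have [g1 g1E] := projX _ _ p (kmor_comp f (dsum_inj1 X Y)) p_surj.
have [g2 g2E] := projY _ _ p (kmor_comp f (dsum_inj2 X Y)) p_surj.
exists (dsum_copair g1 g2) => a [x y].
rewrite -[dsum_copair _ _ a _]/(g1 a x + g2 a y) linearD g1E g2E.
rewrite -[LHS]/(f a (x, 0) + f a (0, y)) -linearD.
by congr (f a (_, _)); rewrite ?addr0 ?add0r.
Qed.

End DirectSum.

(** * The cone resolution of a cokernel *)

Section ConeResolution.
Variables (k : comPzRingType) (C : category) (A B : kfunctor k C).
Variables (i : kmor A B) (i_inj : forall a, injective (i a)).
Hypothesis projA : projective A.
Variable P : proj_resolution B.

Definition cone_lift : kmor A (res_obj P 0) :=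
  sval (cid (@projA _ _ (res_aug P) i (@res_aug_surj _ _ _ P))).

Lemma cone_liftE a x : res_aug P a (cone_lift a x) = i a x.
Proof. by rewrite /cone_lift; case: cid. Qed.

(* The mapping cone of a lift of [A -> B] to [A -> P_0]: it differs from [P]
   only by the summand [A] in degree 1. *)
Definition cone_obj n : kfunctor k C :=
  if n is 1 then dsum (res_obj P 1) A else res_obj P n.

(** [A] is a complex concentrated in one degree, so it contributes no differential of its own and no
    signs appear; the differential out of degree 2 has component 0 in [A]. *)
Definition cone_d n : kmor (cone_obj n.+1) (cone_obj n) :=
  match n with
  | 0 => dsum_copair (res_d P 0) cone_lift
  | 1 => kmor_comp (dsum_inj1 (res_obj P 1) A) (res_d P 1)
  | m.+2 => res_d P m.+2
  end.

Lemma coker_projN a b (f : hom a b) x :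
  quot_proj (img_sub (i b)) (kmap B f x) =
  kmap (cokernel i) f (quot_proj (img_sub (i a)) x).
Proof. by rewrite /= quot_liftE. Qed.
Definition coker_proj : kmor B (cokernel i) :=
  @KMor k C B (cokernel i) (fun a => quot_proj (img_sub (i a))) coker_projN.

Definition cone_aug : kmor (cone_obj 0) (cokernel i) :=
  kmor_comp coker_proj (res_aug P).

Lemma cone_projective n : projective (cone_obj n).
Proof.
case: n => [|[|n]]; try exact: res_projective.
by apply: dsum_projective => //; apply: res_projective.
Qed.

Lemma cone_aug_surj a (y : cokernel i a) : exists x, cone_aug a x = y.
Proof.
have [x xE] := res_aug_surj P (repr y : B a); exists x.
by rewrite /= xE quot_projK.
Qed.

Lemma cone_exact0 a x : cone_aug a x = 0 <-> exists y, cone_d 0 a y = x.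
Proof.
rewrite -[cone_aug a x]/(quot_proj (img_sub (i a)) (res_aug P a x)).
rewrite -(linear0 (quot_proj _)) quot_projP subr0.
split=> [/asboolP[y yx]|[[y z] <-]].
  (* When the augmentation of [x] is [i y], subtracting the lift of [y] leaves an element that the
     augmentation kills, hence a boundary of [P]. *)
  have /res_exact0[z zE] : res_aug P a (x - cone_lift a y) = 0.
    by rewrite linearB cone_liftE yx subrr.
  exists (z, y); rewrite -[LHS]/(res_d P 0 a z + cone_lift a y).
  by rewrite zE subrK.
apply/asboolP; exists z.
rewrite -[cone_d _ _ _]/(res_d P 0 a y + cone_lift a z).
by rewrite linearD cone_liftE res_aug_d add0r.
Qed.

Lemma cone_exactS n a x : cone_d n a x = 0 <-> exists y, cone_d n.+1 a y = x.
Proof.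
case: n x => [|[|n]] x; last exact: res_exactS.
  case: x => x y; rewrite -[cone_d _ _ _]/(res_d P 0 a x + cone_lift a y).
  split=> [xy0|[z /= [<- <-]]]; last by rewrite res_dd linear0 addr0.
  (* Augmenting the cycle equation kills the part from [P] and leaves [i y = 0]. Injectivity of [i]
     thus makes every cycle in degree 1 a cycle of [P]. *)
  have y0 : y = 0.
    apply: (@i_inj a); have := congr1 (res_aug P a) xy0.
    by rewrite linearD res_aug_d add0r cone_liftE !linear0.
  have /res_exactS[z <-] : res_d P 0 a x = 0 by rewrite -xy0 y0 linear0 addr0.
  by exists z; rewrite y0.
split=> [[/res_exactS //]|/res_exactS dx].
by rewrite -[LHS]/(res_d P 1 a x, 0) dx.
Qed.

Definition cone_resolution : proj_resolution (cokernel i) :=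
  ProjResolution cone_projective cone_aug_surj cone_exact0 cone_exactS.

End ConeResolution.

(** * Homology of the tensored cone above degree 1 *)

Section ConeHomology.
Variables (k : comPzRingType) (C : category) (A B : contrafunctor k C).
Variables (i : kmor A B) (i_inj : forall a, injective (i a)).
Hypothesis projA : projective A.
Variables (P : proj_resolution B) (G : kfunctor k C).

(** Tensoring need not preserve injections, but this one is split: the first projection remains a
    retraction after tensoring. *)
Lemma tensor_dsum_inj1_inj (X Y : contrafunctor k C) (z : tensor X G) :
  tensor_map G (dsum_inj1 X Y) z = 0 -> z = 0.
Proof.
pose fst_mor : kmor (dsum X Y) X := @KMor k (opposite C) (dsum X Y) X
  (fun a => (fst : {linear (X a * Y a)%type -> X a})) (fun a b f u => erefl).
move=> /(congr1 (tensor_map G fst_mor)); rewrite -tensor_map_comp linear0 => <-.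
rewrite -[LHS]/(idfun z); apply: tensor_ext z => a x y.
by rewrite tensor_map_pure.
Qed.

Lemma cone_homology n : (1 < n)%N -> lmod_isomorphic
  (homology (tensor_complex G (cone_resolution i_inj projA P)) n)
  (homology (tensor_complex G P) n).
Proof.
case: n => [|[|n]] // _.
have cyclesE z :
    (z \in cycles (tensor_complex G (cone_resolution i_inj projA P)) n.+2) =
    (z \in cycles (tensor_complex G P) n.+2).
  (* Above degree 2 the differentials are literally the same. In degree 2 that of the cone is
     followed by the inclusion of a summand, which does not change the kernel. *)
  case: n z => [|//] z; apply/eqP/eqP => dz; last first.
    rewrite -[LHS]/(tensor_map G
      (kmor_comp (dsum_inj1 (res_obj P 1) A) (res_d P 1)) z).
    by rewrite tensor_map_comp [tensor_map G (res_d P 1) z]dz linear0.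
  apply: (@tensor_dsum_inj1_inj (res_obj P 1) A).
  by rewrite -tensor_map_comp; exact: dz.
apply: (@homology_iso_can k (tensor_complex G (cone_resolution i_inj projA P))
  (tensor_complex G P) n.+2 idfun idfun) => // z.
- by rewrite cyclesE.
- by rewrite cyclesE.
- by apply/asboolP; exists z.
- by apply/asboolP; exists z.
Qed.

(* The long exact sequence of [0 -> A -> B -> B/A -> 0], in the range where
   Tor of the projective [A] vanishes. *)
Theorem Tor_cokernel n : (1 < n)%N ->
  lmod_isomorphic (Tor n (cokernel i) G) (homology (tensor_complex G P) n).
Proof.
move=> n_gt1; apply: lmod_isomorphic_trans (cone_homology n_gt1).
exact: tensor_homology_unique.
Qed.

End ConeHomology.

(** * Restriction of contravariant functors along a left adjoint *)

Record adjunction (C D : category) (L : cfunctor C D) (R : cfunctor D C) :=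
  Adjunction {
    adj_unit : forall c, hom c (R (L c));
    adj_counit : forall d, hom (L (R d)) d;
    unitN : forall a b (f : hom a b),
      cmp (adj_unit b) f = cmp (cmap R (cmap L f)) (adj_unit a);
    counitN : forall a b (f : hom a b),
      cmp (adj_counit b) (cmap L (cmap R f)) = cmp f (adj_counit a);
    unit_counit : forall c,
      cmp (adj_counit (L c)) (cmap L (adj_unit c)) = idm (L c);
    counit_unit : forall d,
      cmp (cmap R (adj_counit d)) (adj_unit (R d)) = idm (R d) }.

Section AdjointPrecomposition.
Variables (k : comPzRingType) (C D : category).
Variables (L : cfunctor C D) (R : cfunctor D C) (adj : adjunction L R).

Local Notation pullL := (precomp (cfunctor_op L)).
Local Notation pullR := (precomp (cfunctor_op R)).

(** This is functoriality with the composite written in [E] instead of [opposite E], so that the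
    adjunction identities can be rewritten under [kmap]. *)
Lemma contra_mapM (E : category) (T : contrafunctor k E) (a b c : E)
    (g : hom b c) (f : hom a b) (x : T c) :
  @kmap _ _ T c a (cmp g f) x = @kmap _ _ T b a f (@kmap _ _ T c b g x).
Proof. exact: (@kmapM _ _ T). Qed.

Section PrecompMorphism.
Variables (T U : contrafunctor k D) (p : kmor T U).
Lemma precomp_kmor_subproof (a b : opposite C) (f : hom a b) (x : (pullL T) a) :
  p (L b) (kmap (pullL T) f x) = kmap (pullL U) f (p (L a) x).
Proof. exact: kappN. Qed.
Definition precomp_kmor : kmor (pullL T) (pullL U) :=
  @KMor k (opposite C) (pullL T) (pullL U) (fun a => p (L a))
    precomp_kmor_subproof.
End PrecompMorphism.

(* On contravariant functors [pullL] is left adjoint to the exact functor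
   [pullR]; the proof lifts the adjunct [f'] of [f] and transposes back. *)
Lemma precomp_projective (P : contrafunctor k D) :
  projective P -> projective (pullL P).
Proof.
move=> projP X Y p f p_surj.
pose f' d : {linear P d -> Y (R d)} :=
  f (R d) \o @kmap _ _ P d (L (R d)) (adj_counit adj d).
have f'N (a b : opposite D) (h : hom a b) x :
    f' b (kmap P h x) = kmap (pullR Y) h (f' a x).
  apply: etrans (kappN f (a := R a) (b := R b) (@cmap D C R b a h)
    (kmap P _ x)).
  rewrite /=; congr (f _ _).
  by rewrite -!contra_mapM counitN.
have [a y|g gE] := projP _ _
  (@KMor k (opposite D) (pullR X) (pullR Y) (fun d => p (R d))
     (fun a b h x => kappN p _ x))
  (@KMor k (opposite D) P (pullR Y) f' f'N).
  exact: p_surj.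
pose g' c : {linear P (L c) -> X c} :=
  @kmap _ _ X (R (L c)) c (adj_unit adj c) \o g (L c).
have g'N (a b : opposite C) (h : hom a b) x :
    g' b (kmap (pullL P) h x) = kmap X h (g' a x).
  by rewrite /= kappN /= -!contra_mapM unitN.
exists (@KMor k (opposite C) (pullL P) X g' g'N) => c x.
rewrite /= kappN [p _ _]gE.
apply: etrans (esym (kappN f (a := R (L c)) (b := c) (adj_unit adj c)
  (kmap P _ x))) _.
rewrite /= -contra_mapM unit_counit.
by congr (f c _); apply: (@kmap1 k (opposite D) P (L c)).
Qed.

(** Surjectivity and exactness are conditions at each object, so they are inherited at [L a]; only
    projectivity relies on the adjunction. *)
Definition precomp_resolution (T : contrafunctor k D) (P : proj_resolution T) :
    proj_resolution (pullL T) :=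
  @ProjResolution k (opposite C) (pullL T) (fun n => pullL (res_obj P n))
    (fun n => precomp_kmor (res_d P n)) (precomp_kmor (res_aug P))
    (fun n => precomp_projective (@res_projective _ _ _ P n))
    (fun a => @res_aug_surj _ _ _ P (L a))
    (fun a => @res_exact0 _ _ _ P (L a))
    (fun n a => @res_exactS _ _ _ P n (L a)).

Section TensorAdjunction.
Variable G : kfunctor k C.

Section TensorMaps.
Variable T : contrafunctor k D.

(** The unit moves [y] from [G c] to [G (R (L c))], the value of [precomp R G] at the object [L c]
    where [x] lives. *)
Definition tensor_adj_free :
    {linear freemod k (tensor_index (pullL T) G) -> tensor T (precomp R G)} :=
  free_lift (fun u : tensor_index (pullL T) G =>
    pure (G := precomp R G) (a := L (tag u)) (tagged u).1
      (kmap G (adj_unit adj (tag u)) (tagged u).2)).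

Lemma tensor_adj_freeE (c : C) (x : (pullL T) c) (y : G c) :
  tensor_adj_free (elt x y) =
  pure (G := precomp R G) (a := L c) x (kmap G (adj_unit adj c) y).
Proof. exact: free_lift_gen. Qed.

Lemma tensor_adj_subproof u : u \in span_sub (@tensor_rel k C (pullL T) G) ->
  tensor_adj_free u = 0.
Proof.
move: u; apply: span_sub_ker => u.
case=> [a x1 x2 y|a x y1 y2|a c x y|a c x y|a b f x y].
- by rewrite linearB linearD !tensor_adj_freeE pureDl subrr.
- by rewrite linearB linearD !tensor_adj_freeE linearD pureDr subrr.
- by rewrite linearB linearZ /= !tensor_adj_freeE pureZl subrr.
- by rewrite linearB linearZ /= !tensor_adj_freeE linearZ /= pureZr subrr.
- rewrite linearB !tensor_adj_freeE /= pure_hom /= -!kmapM.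
  by rewrite unitN subrr.
Qed.

Definition tensor_adj : {linear tensor (pullL T) G -> tensor T (precomp R G)} :=
  quot_lift tensor_adj_subproof.

Lemma tensor_adj_pure (c : C) (x : (pullL T) c) (y : G c) :
  tensor_adj (pure x y) =
  pure (G := precomp R G) (a := L c) x (kmap G (adj_unit adj c) y).
Proof. by rewrite /tensor_adj /pure /= quot_liftE tensor_adj_freeE. Qed.

(** Dually, the counit pulls [x] back from [T d] to [T (L (R d))], the value of the restricted
    functor at the object [R d] where [y] is evaluated. *)
Definition tensor_coadj_free :
    {linear freemod k (tensor_index T (precomp R G)) -> tensor (pullL T) G} :=
  free_lift (fun u : tensor_index T (precomp R G) =>
    pure (T := pullL T) (G := G) (a := R (tag u))
      (@kmap _ _ T (tag u) (L (R (tag u))) (adj_counit adj (tag u))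
        (tagged u).1)
      (tagged u).2).

Lemma tensor_coadj_freeE (d : D) (x : T d) (y : precomp R G d) :
  tensor_coadj_free (elt x y) =
  pure (T := pullL T) (G := G) (a := R d)
    (@kmap _ _ T d (L (R d)) (adj_counit adj d) x) y.
Proof. exact: free_lift_gen. Qed.

Lemma tensor_coadj_subproof u :
  u \in span_sub (@tensor_rel k D T (precomp R G)) -> tensor_coadj_free u = 0.
Proof.
move: u; apply: span_sub_ker => u.
case=> [a x1 x2 y|a x y1 y2|a c x y|a c x y|a b f x y].
- by rewrite linearB linearD !tensor_coadj_freeE linearD pureDl subrr.
- by rewrite linearB linearD !tensor_coadj_freeE pureDr subrr.
- by rewrite linearB linearZ /= !tensor_coadj_freeE linearZ /= pureZl subrr.
- by rewrite linearB linearZ /= !tensor_coadj_freeE pureZr subrr.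
- rewrite linearB !tensor_coadj_freeE /= -pure_hom /= -!contra_mapM.
  by rewrite counitN subrr.
Qed.

Definition tensor_coadj :
    {linear tensor T (precomp R G) -> tensor (pullL T) G} :=
  quot_lift tensor_coadj_subproof.

Lemma tensor_coadj_pure (d : D) (x : T d) (y : precomp R G d) :
  tensor_coadj (pure x y) =
  pure (T := pullL T) (G := G) (a := R d)
    (@kmap _ _ T d (L (R d)) (adj_counit adj d) x) y.
Proof. by rewrite /tensor_coadj /pure /= quot_liftE tensor_coadj_freeE. Qed.

(** The coend relation carries the unit over to the contravariant factor, where a triangle identity
    cancels it against the counit. The other composite uses the other triangle on the covariant
    factor. *)
Lemma tensor_adjK : cancel tensor_adj tensor_coadj.
Proof.
move=> z; rewrite -[LHS]/((tensor_coadj \o tensor_adj) z) -[RHS]/(idfun z).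
apply: tensor_ext z => c x y /=; rewrite tensor_adj_pure tensor_coadj_pure.
rewrite -pure_hom /= -contra_mapM unit_counit.
by congr (pure _ _); apply: (@kmap1 k (opposite D) T (L c)).
Qed.

Lemma tensor_coadjK : cancel tensor_coadj tensor_adj.
Proof.
move=> z; rewrite -[LHS]/((tensor_adj \o tensor_coadj) z) -[RHS]/(idfun z).
apply: tensor_ext z => d x y /=; rewrite tensor_coadj_pure tensor_adj_pure.
rewrite pure_hom /= -kmapM counit_unit.
by rewrite kmap1.
Qed.

End TensorMaps.

Lemma tensor_adjN (T U : contrafunctor k D) (p : kmor T U) z :
  tensor_adj U (tensor_map G (precomp_kmor p) z) =
  tensor_map (precomp R G) p (tensor_adj T z).
Proof.
rewrite -[LHS]/((tensor_adj U \o tensor_map G (precomp_kmor p)) z).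
rewrite -[RHS]/((tensor_map (precomp R G) p \o tensor_adj T) z).
apply: tensor_ext z => c x y /=.
by rewrite tensor_map_pure !tensor_adj_pure tensor_map_pure.
Qed.

Lemma tensor_coadjN (T U : contrafunctor k D) (p : kmor T U) z :
  tensor_coadj U (tensor_map (precomp R G) p z) =
  tensor_map G (precomp_kmor p) (tensor_coadj T z).
Proof.
rewrite -[LHS]/((tensor_coadj U \o tensor_map (precomp R G) p) z).
rewrite -[RHS]/((tensor_map G (precomp_kmor p) \o tensor_coadj T) z).
apply: tensor_ext z => d x y /=.
by rewrite tensor_map_pure !tensor_coadj_pure tensor_map_pure /= kappN.
Qed.

Lemma precomp_homology (T : contrafunctor k D) (P : proj_resolution T) n :
  lmod_isomorphic (homology (tensor_complex G (precomp_resolution P)) n)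
                  (homology (tensor_complex (precomp R G) P) n).
Proof.
apply: (@homology_iso_can k (tensor_complex G (precomp_resolution P))
  (tensor_complex (precomp R G) P) n
  (tensor_adj (res_obj P n)) (tensor_coadj (res_obj P n))) => z.
- case: n z => [//|n] z /eqP zc; apply/eqP.
  apply: etrans (esym (tensor_adjN _ _)) _.
  by rewrite [tensor_map _ _ z]zc linear0.
- case: n z => [//|n] z /eqP zc; apply/eqP.
  apply: etrans (esym (tensor_coadjN _ _)) _.
  by rewrite [tensor_map _ _ z]zc linear0.
- by apply/asboolP; exists (tensor_adj _ z); apply: esym (tensor_adjN _ _).
- by apply/asboolP; exists (tensor_coadj _ z); apply: esym (tensor_coadjN _ _).
- exact: tensor_adjK.
- exact: tensor_coadjK.
Qed.

End TensorAdjunction.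
End AdjointPrecomposition.

(** * Representable functors, the adjunction of [nu] and [mu], and the conclusion *)

Lemma representable_projective (k : comPzRingType) (C : category) (a : C) :
  projective (representable k a).
Proof.
(* By Yoneda, a morphism out of a representable is determined by the image of the identity, so
   lifting that one element suffices. *)
move=> X Y p f p_surj; have [x xE] := p_surj a (f a (gen (idm a))).
pose g b : {linear representable k a b -> X b} :=
  free_lift (fun h : hom a b => kmap X h x).
have gN b c (h : hom b c) u :
    g c (kmap (representable k a) h u) = kmap X h (g b u).
  rewrite -[LHS]/((g c \o kmap (representable k a) h) u).
  rewrite -[RHS]/((kmap X h \o g b) u); apply: free_ext u => u /=.
  by rewrite !free_lift_gen kmapM.
exists (KMor gN) => b u; rewrite -[LHS]/((p b \o g b) u).
apply: free_ext u => h /=; rewrite free_lift_gen kappN xE -kappN /=.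
by rewrite free_lift_gen cmpm1.
Qed.

(** The added basepoint is folded onto the original one, which sits at position 1 of the source;
    every other point is shifted back down. *)
Definition mu_counit_fun n : fin_hom n.+1 n :=
  [ffun i => if unlift ord0 i is Some j then j else ord0].

Lemma mu_counit_subproof n : mu_counit_fun n ord0 == ord0.
Proof. by rewrite ffunE unlift_none. Qed.

Definition mu_counit (n : Gamma) : hom (nu (mu n)) n :=
  exist _ (mu_counit_fun n) (mu_counit_subproof n).

Definition nu_unit (n : Fin) : hom n (mu (nu n)) :=
  [ffun i : 'I_n.+1 => lift ord0 i].

Lemma nu_unitN (a b : Fin) (f : hom a b) :
  cmp (nu_unit b) f = cmp (cmap mu (cmap nu f)) (nu_unit a).
Proof. by apply/ffunP => i; rewrite !ffunE liftK. Qed.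

Lemma mu_counitN (a b : Gamma) (f : hom a b) :
  cmp (mu_counit b) (cmap nu (cmap mu f)) = cmp f (mu_counit a).
Proof.
apply: val_inj; apply/ffunP => i; rewrite /= !ffunE.
(* At the added point the right side is the image of the basepoint under [f]; here pointedness of
   [f] enters. *)
by case: (unliftP ord0 i) => [j _|_]; rewrite ?liftK // unlift_none
  (eqP (valP f)).
Qed.

Lemma nu_unit_counit (c : Fin) :
  cmp (mu_counit (nu c)) (cmap nu (nu_unit c)) = idm (nu c).
Proof.
apply: val_inj; apply/ffunP => i; rewrite /= !ffunE.
by case: (unliftP ord0 i) => [j ->|->]; rewrite ?ffunE ?liftK ?unlift_none.
Qed.

Lemma mu_counit_unit (d : Gamma) :
  cmp (cmap mu (mu_counit d)) (nu_unit (mu d)) = idm (mu d).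
Proof. by apply/ffunP => i; rewrite /= !ffunE liftK. Qed.

Definition nu_mu_adjunction : adjunction nu mu :=
  Adjunction nu_unitN mu_counitN nu_unit_counit mu_counit_unit.

Theorem corollary4p4 (k : comPzRingType) (F : kfunctor k Fin) (n : nat) :
  (1 < n)%N ->
  lmod_isomorphic (HGammaC n F) (HGamma n (precomp mu F)).
Proof.
move=> n_gt1.
pose P := precomp_resolution nu_mu_adjunction (free_resolution (tfun k)).
apply: lmod_isomorphic_trans
  (precomp_homology nu_mu_adjunction F (free_resolution (tfun k)) n).
(* By definition [tbar] is the cokernel of [F0_to_nu_t], and [F0] is representable on
   [opposite Fin], hence projective. *)
exact: (@Tor_cokernel _ _ _ _ _ (@F0_to_nu_t_inj k)
  (@representable_projective k (opposite Fin) 0%N) P F n n_gt1).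
Qed.
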